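(* Let $P=\{x\in\mathbb{R}^n : H^Tx\le \mathbb{1}\}$ be a full-dimensional polytope with the origin in its interior, with $f$ facets and $v$ vertices, and let $K\subset\mathbb{R}^m$ be a closed convex cone. Let $A$ be a nonnegative $K^*$-map from $\mathbb{R}^f$ to $\mathbb{R}^m$ and $B$ a nonnegative $K$-map from $\mathbb{R}^v$ to $\mathbb{R}^m$. Then $$\mathrm{Inn}_P(A)\subseteq P\subseteq \mathrm{Out}_P(B).$$
   Context: Dual spaces are identified with the spaces themselves via the standard inner product; $\|\cdot\|$ is the Euclidean norm and $\mathbb{1}$ is the all-ones vector. $H=[h_1\ \cdots\ h_f]$ is an $n\times f$ matrix such that each inequality $\langle h_i,x\rangle\le 1$ defines a facet of $P$ (one for each facet); $p_1,\dots,p_v$ are the vertices of $P$ and $V=[p_1\ \cdots\ p_v]$ is $n\times v$. $K^*=\{y : \langle y,x\rangle\ge 0\ \forall x\in K\}$ is the dual cone. A nonnegative $K$-map $B:\mathbb{R}^v\to\mathbb{R}^m$ is a linear map with $B(\mathbb{R}^v_+)\subseteq K$ (i.e. $B(e_j)\in K$ for all $j$); similarly a nonnegative $K^*$-map $A:\mathbb{R}^f\to\mathbb{R}^m$ satisfies $A(\mathbb{R}^f_+)\subseteq K^*$. $A^*$ is the adjoint (transpose) of $A$, and $H^*(x)=H^Tx$. Cones: $\mathcal{O}_{in}^k=\{x\in\mathbb{R}^k : \sqrt{k-1}\,\|x\|\le \mathbb{1}^Tx\}$ and $\mathcal{O}_{out}^k=\{x\in\mathbb{R}^k : \|x\|\le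 \mathbb{1}^Tx\}$. Definitions: $\mathrm{Inn}_P(A)=\{x\in\mathbb{R}^n : \exists y\in K \text{ such that } \mathbb{1}-H^*(x)-A^*(y)\in\mathcal{O}_{in}^f\}$, $\mathrm{Out}_P(B)=\{V(z) : z\in\mathcal{O}_{out}^v,\ \mathbb{1}^Tz\le 1,\ B(z)\in K\}$. *)

(* Defs.v *)
From mathcomp Require Import all_boot all_order all_algebra.
From mathcomp Require Import all_classical all_reals all_analysis.
Import Order.TTheory GRing.Theory Num.Theory.
Import numFieldNormedType.Exports.

Set Implicit Arguments.
Unset Strict Implicit.
Unset Printing Implicit Defensive.

Local Open Scope classical_set_scope.
Local Open Scope ring_scope.

Definition dotv (R : realType) (n : nat) (x y : 'cV[R]_n) : R :=
  \sum_i x i 0 * y i 0.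

(* The norm `|x| of the library on matrices is the sup norm; this is the
   Euclidean one. *)
Definition enorm (R : realType) (n : nat) (x : 'cV[R]_n) : R :=
  Num.sqrt (dotv x x).

Definition ones (R : realType) (n : nat) : 'cV[R]_n := const_mx 1.

Definition orthant (R : realType) (k : nat) : set 'cV[R]_k :=
  [set x | forall i, 0 <= x i 0].

Definition O_in (R : realType) (k : nat) : set 'cV[R]_k :=
  [set x | Num.sqrt (k%:R - 1) * enorm x <= dotv (ones R k) x].

Definition O_out (R : realType) (k : nat) : set 'cV[R]_k :=
  [set x | enorm x <= dotv (ones R k) x].

Definition is_cone (R : realType) (m : nat) (K : set 'cV[R]_m) : Prop :=
  K !=set0 /\ (forall t x, 0 <= t -> K x -> K (t *: x)).

Definition dual_cone (R : realType) (m : nat) (K : set 'cV[R]_m) :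
    set 'cV[R]_m :=
  [set y | forall x, K x -> 0 <= dotv y x].

(* Linear maps R^k -> R^m are represented by m x k matrices, acting by
   x |-> A *m x, so that the adjoint is the transpose. *)
Definition nonneg_map (R : realType) (m k : nat) (K : set 'cV[R]_m)
    (A : 'M[R]_(m, k)) : Prop :=
  forall x, orthant x -> K (A *m x).

Definition is_polytope (R : realType) (n : nat) (P : set 'cV[R]_n) : Prop :=
  (exists (k : nat) (c : 'I_k -> 'cV[R]_n) (d : 'I_k -> R),
     P = [set x | forall i, dotv (c i) x <= d i])
  /\ bounded_set P.

Definition affinely_independent (R : realType) (n k : nat)
    (q : 'I_k -> 'cV[R]_n) : Prop :=
  forall a : 'I_k -> R,
    \sum_i a i = 0 -> \sum_i a i *: q i = 0 -> forall i, a i = 0.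

(* One less than the maximal number of affinely independent points of S;
   in particular the empty set has dimension -1. *)
Definition has_dim (R : realType) (n : nat) (S : set 'cV[R]_n) (d : int) :
    Prop :=
  exists k : nat,
    [/\ d = k%:Z - 1,
        exists q : 'I_k -> 'cV[R]_n,
          (forall i, S (q i)) /\ affinely_independent q
      & forall q : 'I_k.+1 -> 'cV[R]_n,
          (forall i, S (q i)) -> ~ affinely_independent q].

Definition is_face (R : realType) (n : nat) (P F : set 'cV[R]_n) : Prop :=
  exists (c : 'cV[R]_n) (d : R),
    (forall x, P x -> dotv c x <= d) /\ F = P `&` [set x | dotv c x = d].

Definition is_facet (R : realType) (n : nat) (P F : set 'cV[R]_n) : Prop :=
  is_face P F /\ has_dim F (n%:Z - 1).

Definition is_vertex (R : realType) (n : nat) (P : set 'cV[R]_n)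
    (p : 'cV[R]_n) : Prop :=
  is_face P [set p].

Definition columns_define_facets (R : realType) (n f : nat)
    (P : set 'cV[R]_n) (H : 'M[R]_(n, f)) : Prop :=
  let F i := P `&` [set x | dotv (col i H) x = 1] in
  (forall i, is_facet P (F i)) /\
  (forall G, is_facet P G -> exists! i, G = F i).

Definition columns_are_vertices (R : realType) (n v : nat)
    (P : set 'cV[R]_n) (V : 'M[R]_(n, v)) : Prop :=
  (forall j, is_vertex P (col j V)) /\
  (forall p, is_vertex P p -> exists! j, p = col j V).

Definition polyhedron (R : realType) (n f : nat) (H : 'M[R]_(n, f)) :
    set 'cV[R]_n :=
  [set x | forall i, (H^T *m x) i 0 <= ones R f i 0].

Definition Inn (R : realType) (n f m : nat) (H : 'M[R]_(n, f))
    (K : set 'cV[R]_m) (A : 'M[R]_(m, f)) : set 'cV[R]_n :=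
  [set x | exists2 y, K y & O_in (ones R f - H^T *m x - A^T *m y)].

Definition Out (R : realType) (n v m : nat) (V : 'M[R]_(n, v))
    (K : set 'cV[R]_m) (B : 'M[R]_(m, v)) : set 'cV[R]_n :=
  [set V *m z | z in [set z | [/\ O_out z, dotv (ones R v) z <= 1
                                & K (B *m z)]]].

(* Main.v *)
(* Inner inclusion: O_in is contained in the nonnegative orthant, and
   A^T y >= 0 for y in K, so 1 - H^T x >= A^T y >= 0.  Outer inclusion: the
   nonnegative orthant is contained in O_out, so the coefficients of x in P as
   a convex combination of vertices are an admissible z.  That P is the convex
   hull of its vertices is shown by induction on the number of constraints
   that are slack at x: if the gradients of the tight ones span, x is exposed
   by their sum; otherwise x lies strictly between two points of P, obtained
   by moving along a common null direction until a new constraint is tight. *)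
Require Import Defs.
From mathcomp Require Import all_boot all_order all_algebra.
From mathcomp Require Import ring lra.
From mathcomp Require Import all_classical all_reals all_analysis.
Import Order.TTheory GRing.Theory Num.Theory.
Import numFieldNormedType.Exports.
Local Open Scope classical_set_scope.
Local Open Scope ring_scope.


Set Implicit Arguments.
Unset Strict Implicit.
Unset Printing Implicit Defensive.

(** * Bilinearity of the inner product *)

Lemma dotvDr (R : realType) (n : nat) (c x y : 'cV[R]_n) :
  dotv c (x + y) = dotv c x + dotv c y.
Proof.
rewrite /dotv -big_split /=; apply: eq_bigr => i _.
by rewrite mxE mulrDr.
Qed.

Lemma dotvZr (R : realType) (n : nat) (c x : 'cV[R]_n) (t : R) :
  dotv c (t *: x) = t * dotv c x.
Proof.
rewrite /dotv mulr_sumr; apply: eq_bigr => i _.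
by rewrite mxE mulrCA.
Qed.

Lemma dotvNr (R : realType) (n : nat) (c x : 'cV[R]_n) :
  dotv c (- x) = - dotv c x.
Proof. by rewrite -scaleN1r dotvZr mulN1r. Qed.

Lemma dotv_suml (R : realType) (n : nat) (I : finType) (T : pred I)
    (c : I -> 'cV[R]_n) (x : 'cV[R]_n) :
  dotv (\sum_(i | T i) c i) x = \sum_(i | T i) dotv (c i) x.
Proof.
rewrite /dotv exchange_big /=; apply: eq_bigr => j _.
by rewrite summxE mulr_suml.
Qed.

Lemma dotv_ones (R : realType) (n : nat) (x : 'cV[R]_n) :
  dotv (ones R n) x = \sum_i x i 0.
Proof. by apply: eq_bigr => i _; rewrite mxE mul1r. Qed.

Lemma mul_trmx_dotv (R : realType) (n k : nat) (M : 'M[R]_(n, k))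
    (x : 'cV[R]_n) (i : 'I_k) : (M^T *m x) i 0 = dotv (col i M) x.
Proof. by rewrite mxE; apply: eq_bigr => j _; rewrite !mxE. Qed.

Lemma polyhedronP (R : realType) (n f : nat) (H : 'M[R]_(n, f))
    (x : 'cV[R]_n) :
  polyhedron H x <-> forall i, dotv (col i H) x <= 1.
Proof.
by split=> Hx i; move: (Hx i); rewrite mul_trmx_dotv mxE.
Qed.

(** * The two cones compared with the nonnegative orthant *)

(** Cauchy-Schwarz against the indicator of [T]: expand the squares of [#|T| * a i - s], with [s]
    the sum. *)
Lemma sum_sqr_le (R : realFieldType) (I : finType) (T : pred I) (a : I -> R) :
  (\sum_(i | T i) a i) ^+ 2 <= #|T|%:R * \sum_(i | T i) a i ^+ 2.
Proof.
set s := \sum_(i | T i) a i; set q := \sum_(i | T i) a i ^+ 2.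
have [T0|T_gt0] := posnP #|T|.
  rewrite /s big_pred0 ?T0 ?mul0r ?expr0n //.
  by move=> i; move/card0_eq: T0 => /(_ i).
have k_gt0 : 0 < #|T|%:R :> R by rewrite ltr0n.
have : 0 <= \sum_(i | T i) (#|T|%:R * a i - s) ^+ 2.
  by apply: sumr_ge0 => i _; exact: sqr_ge0.
rewrite (_ : \sum_(i | T i) _ = #|T|%:R * (#|T|%:R * q - s ^+ 2)).
  by rewrite pmulr_rge0 // subr_ge0.
transitivity (\sum_(i | T i)
  (#|T|%:R ^+ 2 * a i ^+ 2 + - (2 * #|T|%:R * s) * a i + s ^+ 2)).
  by apply: eq_bigr => i _; ring.
rewrite !big_split /= -!mulr_sumr sumr_const -/s -/q -mulr_natl.
by ring.
Qed.

Lemma dotv_sqr (R : realType) (n : nat) (x : 'cV[R]_n) :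
  dotv x x = \sum_i x i 0 ^+ 2.
Proof. by apply: eq_bigr => i _; rewrite expr2. Qed.

Lemma dotvv_ge0 (R : realType) (n : nat) (x : 'cV[R]_n) : 0 <= dotv x x.
Proof. by rewrite dotv_sqr; apply: sumr_ge0 => i _; exact: sqr_ge0. Qed.

(** If [x i < 0], the other [k - 1] coordinates sum to [s - x i > s >= 0]. Cauchy-Schwarz bounds the
    square of this sum by [(k - 1) * (dotv x x - x i ^+ 2)], which is at most [s ^+ 2]. *)
Lemma O_in_orthant (R : realType) (k : nat) : @O_in R k `<=` @orthant R k.
Proof.
move=> x /= Hx i; rewrite leNgt; apply/negP => xi_lt0.
have k_gt0 : (0 < k)%N by apply: leq_trans (ltn_ord i).
have k1_ge0 : 0 <= k%:R - 1 :> R by rewrite subr_ge0 ler1n.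
set s := dotv (ones R k) x in Hx.
have s_ge0 : 0 <= s by apply: le_trans Hx; rewrite mulr_ge0 ?sqrtr_ge0.
have s_sqr : (k%:R - 1) * dotv x x <= s ^+ 2.
  move: Hx; rewrite /O_in /enorm /= -sqrtrM //.
  rewrite -(ler_sqr (x := Num.sqrt _)) ?nnegrE ?sqrtr_ge0 //.
  by rewrite sqr_sqrtr // mulr_ge0 ?dotvv_ge0.
have := sum_sqr_le (fun j => j != i) (fun j => x j 0).
have -> : #|(fun j => j != i)|%:R = k%:R - 1 :> R.
  have -> : #|(fun j => j != i)| = k.-1 by rewrite (cardC1 i) card_ord.
  by rewrite -{2}(prednK k_gt0) -natr1 addrK.
have -> : \sum_(j | j != i) x j 0 = s - x i 0.
  by rewrite /s dotv_ones [in RHS](bigD1 i) //= addrAC subrr add0r.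
have -> : \sum_(j | j != i) x j 0 ^+ 2 = dotv x x - x i 0 ^+ 2.
  by rewrite dotv_sqr [in RHS](bigD1 i) //= addrAC subrr add0r.
have := mulr_ge0 k1_ge0 (sqr_ge0 (x i 0)).
nra.
Qed.

(** Each coordinate is at most the sum [s] of all, so the squares add up to at most [s ^+ 2]. *)
Lemma orthant_O_out (R : realType) (k : nat) : @orthant R k `<=` @O_out R k.
Proof.
move=> x /= x_ge0; rewrite /O_out /= dotv_ones.
have s_ge0 : 0 <= \sum_i x i 0 by apply: sumr_ge0.
rewrite -(ler_sqr (x := enorm x)) ?nnegrE ?sqrtr_ge0 //.
rewrite sqr_sqrtr ?dotvv_ge0 // expr2 mulr_suml; apply: ler_sum => i _.
apply: ler_wpM2l => //; rewrite (bigD1 i) //= lerDl.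
by apply: sumr_ge0.
Qed.

Lemma nonneg_map_col (R : realType) (m k : nat) (K : set 'cV[R]_m)
    (A : 'M[R]_(m, k)) (i : 'I_k) : nonneg_map K A -> K (col i A).
Proof.
move=> A_nonneg; rewrite colE; apply: A_nonneg => j.
by rewrite mxE; case: (_ && _).
Qed.

(** * A bounded polyhedron as the hull of its vertices *)

Section PolytopeHull.
Context (R : realType) (n f : nat) (H : 'M[R]_(n, f)).
Implicit Types (x d : 'cV[R]_n) (i : 'I_f).

Definition slack x : {set 'I_f} := [set i | dotv (col i H) x != 1].

Lemma slackPn x i : reflect (dotv (col i H) x = 1) (i \notin slack x).
Proof. by rewrite inE negbK; exact: eqP. Qed.

Lemma tight_exposed x :
    polyhedron H x ->
    (forall d, (forall i, i \notin slack x -> dotv (col i H) d = 0) -> d = 0) ->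
  is_vertex (polyhedron H) x.
Proof.
move=> /[dup] Px /polyhedronP Hx tight_span.
exists (\sum_(i | i \notin slack x) col i H),
  (\sum_(i | i \notin slack x) 1).
split=> [y /polyhedronP Hy|]; first by rewrite dotv_suml; apply: ler_sum.
apply/seteqP; split=> [_ -> /=|y [/polyhedronP Hy /= /eqP]].
  by split=> //; rewrite dotv_suml; apply: eq_bigr => i /slackPn.
(* The nonnegative gaps [1 - dotv (col i H) y] over the tight [i] sum to zero, so each vanishes and
   [y - x] is orthogonal to all tight gradients. *)
rewrite dotv_suml eq_sym -subr_eq0 -sumrB psumr_eq0; last first.
  by move=> i _; rewrite subr_ge0.
move=> /allP y_tight; apply/eqP; rewrite -subr_eq0; apply/eqP.
apply: tight_span => i xi.
rewrite dotvDr dotvNr (slackPn _ _ xi); apply/eqP; rewrite -oppr_eq0 opprB.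
by have := y_tight i (mem_index_enum _); rewrite xi.
Qed.

Lemma bounded_polyhedron_ray x d :
  bounded_set (polyhedron H) -> polyhedron H x -> d != 0 ->
  exists i, 0 < dotv (col i H) d.
Proof.
move=> [M [_ bM]] /polyhedronP Hx d_neq0; apply: contrapT => no_i.
have ray (t : R) : 0 <= t -> polyhedron H (x + t *: d).
  move=> t_ge0; apply/polyhedronP => i; rewrite dotvDr dotvZr.
  have : dotv (col i H) d <= 0.
    by rewrite leNgt; apply/negP => ?; apply: no_i; exists i.
  by move/(mulr_ge0_le0 t_ge0); move: (Hx i); lra.
have nd_gt0 : 0 < `|d| by rewrite normr_gt0.
pose N : R := `|M| + 1.
have MN : M < N by rewrite ltr_pwDr // ler_norm.
(* This makes the norm of [t *: d] exceed [N + |x|], so [x + t *: d] leaves the ball of radius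
   [N]. *)
pose t : R := (N + `|x| + 1) / `|d|.
have t_ge0 : 0 <= t by rewrite divr_ge0 // !addr_ge0.
have := bM _ MN _ (ray t t_ge0).
have : `|t *: d| <= `|x + t *: d| + `|x|.
  rewrite -[X in `|X| <= _](addKr x) addrC.
  exact: ler_normB.
rewrite normrZ ger0_norm // divfK ?gt_eqF // => ? /= ?; lra.
Qed.

Lemma move_to_tight x d :
    bounded_set (polyhedron H) -> polyhedron H x -> d != 0 ->
    (forall i, i \notin slack x -> dotv (col i H) d = 0) ->
  exists t, [/\ 0 < t, polyhedron H (x + t *: d)
              & slack (x + t *: d) \proper slack x].
Proof.
move=> Pb Px d_neq0 d_null; have [i0 i0P] := bounded_polyhedron_ray Pb Px d_neq0.
move/polyhedronP in Px.
(* Ratio test: [r i] is the step at which constraint [i] becomes tight. The smallest one, over the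
   constraints that increase along [d], keeps the point feasible. *)
pose r i := (1 - dotv (col i H) x) / dotv (col i H) d.
case: (@arg_minP _ _ _ i0 (fun i => 0 < dotv (col i H) d) r i0P) => j jP jmin.
have j_slack : j \in slack x.
  by apply: contraTT jP => /d_null ->; rewrite ltxx.
have rj_gt0 : 0 < r j.
  rewrite divr_gt0 // subr_gt0 lt_neqAle Px andbT.
  by move: j_slack; rewrite inE.
exists (r j); split=> //.
- apply/polyhedronP => i; rewrite dotvDr dotvZr.
  have [hi_le0|hi_gt0] := leP (dotv (col i H) d) 0.
    by have := mulr_ge0_le0 (ltW rj_gt0) hi_le0; move: (Px i); lra.
  by have := jmin i hi_gt0; rewrite /r ler_pdivlMr // -/(r j); lra.
- apply/properP; split; last first.
    exists j => //; apply/slackPn.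
    by rewrite dotvDr dotvZr /r divfK ?gt_eqF // addrC subrK.
  apply/fintype.subsetP => i; apply: contraLR => xi; apply/slackPn.
  by rewrite dotvDr dotvZr d_null // mulr0 addr0; exact/slackPn.
Qed.

(** The hull enters as an arbitrary [C] closed under binary convex combinations, which is all that
    the induction uses. *)
Lemma polytope_hull (C : set 'cV[R]_n) :
    bounded_set (polyhedron H) ->
    (forall p, is_vertex (polyhedron H) p -> C p) ->
    (forall x y s t, 0 <= s -> 0 <= t -> s + t = 1 -> C x -> C y ->
       C (s *: x + t *: y)) ->
  polyhedron H `<=` C.
Proof.
move=> Pb C_vert C_convex x.
have [k] := ubnP #|slack x|; elim: k x => // k IHk x /ltnSE slack_le Px.
have IH y : polyhedron H y -> slack y \proper slack x -> C y.
  by move=> Py /proper_card lt_yx; apply: IHk => //; exact: leq_trans slack_le.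
have [tight_span|] := pselect
  (forall d, (forall i, i \notin slack x -> dotv (col i H) d = 0) -> d = 0).
  by apply: C_vert; exact: tight_exposed.
move=> /existsNP[d /not_implyP[d_null /eqP d_neq0]].
have Nd_null i : i \notin slack x -> dotv (col i H) (- d) = 0.
  by move/d_null; rewrite dotvNr => ->; rewrite oppr0.
have [t [t_gt0 Pt slack_t]] := move_to_tight Pb Px d_neq0 d_null.
have [s [s_gt0 Ps slack_s]] :
    exists s, [/\ 0 < s, polyhedron H (x + s *: - d)
                & slack (x + s *: - d) \proper slack x].
  by apply: move_to_tight => //; rewrite oppr_eq0.
have st_gt0 : 0 < s + t by exact: addr_gt0.
(* Weights inversely proportional to the step lengths cancel the two displacements. *)
have -> : x = (s / (s + t)) *: (x + t *: d) + (t / (s + t)) *: (x + s *: - d).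
  apply/matrixP => i j; rewrite !mxE; field; exact: lt0r_neq0.
apply: C_convex; rewrite ?divr_ge0 ?(ltW s_gt0) ?(ltW t_gt0) ?(ltW st_gt0) //.
- by rewrite -mulrDl divff // gt_eqF.
- exact: IH.
- exact: IH.
Qed.

End PolytopeHull.

Lemma polytope_convex_combination (R : realType) (n f v : nat)
    (H : 'M[R]_(n, f)) (V : 'M[R]_(n, v)) (x : 'cV[R]_n) :
  bounded_set (polyhedron H) -> columns_are_vertices (polyhedron H) V ->
  polyhedron H x ->
  exists z, [/\ orthant z, dotv (ones R v) z = 1 & V *m z = x].
Proof.
(* Here [C] is the image under [V] of the standard simplex; basis vectors represent the vertices. *)
move=> Pb [_ V_all]; move: x; apply: polytope_hull => //.
- move=> p /V_all[j [-> _]]; exists (delta_mx j 0); split.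
  + by move=> i; rewrite mxE; case: (_ && _).
  + rewrite dotv_ones (bigD1 j) //= big1 => [|i /negPf ij].
      by rewrite mxE !eqxx addr0.
    by rewrite mxE ij.
  + by rewrite -colE.
- move=> _ _ s t s_ge0 t_ge0 st1 [y [y_ge0 y1 <-]] [z [z_ge0 z1 <-]].
  exists (s *: y + t *: z); split.
  + by move=> i; rewrite !mxE addr_ge0 // mulr_ge0.
  + by rewrite dotvDr !dotvZr y1 z1 !mulr1.
  + by rewrite mulmxDr -!scalemxAr.
Qed.

Theorem proposition2p8 (R : realType) (n m f v : nat)
  (H : 'M[R]_(n, f)) (V : 'M[R]_(n, v)) (P : set 'cV[R]_n)
  (P_def : P = polyhedron H)
  (P_polytope : is_polytope P)
  (P_full_dim : has_dim P n%:Z)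
  (P_origin : interior P 0)
  (H_facets : columns_define_facets P H)
  (V_vertices : columns_are_vertices P V)
  (K : set 'cV[R]_m)
  (K_closed : closed K) (K_convex : convex_set K) (K_cone : is_cone K)
  (A : 'M[R]_(m, f)) (A_nonneg : nonneg_map (dual_cone K) A)
  (B : 'M[R]_(m, v)) (B_nonneg : nonneg_map K B) :
  Inn H K A `<=` P /\ P `<=` Out V K B.
Proof.
subst P; case: P_polytope => _ P_bounded; split=> x.
- case=> y Ky /O_in_orthant slack_ge0 i; move: (slack_ge0 i).
  (* Column [i] of [A] lies in the dual cone, so its product with [y], the [i]-th entry of
     [A^T *m y], is nonnegative. *)
  have /= /(_ y Ky) := nonneg_map_col i A_nonneg.
  rewrite -mul_trmx_dotv; move: (H^T *m x) (A^T *m y) => a b.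
  rewrite !mxE; lra.
- move=> /(polytope_convex_combination P_bounded V_vertices)[z [z_ge0 z1 <-]].
  exists z => //; split; first exact: orthant_O_out.
    by rewrite z1.
  exact: B_nonneg.
Qed.
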